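(* Let $\gamma\in[0,2]$, let $\mathcal{O}\subset\mathbb{R}^d$ be a bounded domain, and let $q:\overline{\mathcal{O}}\to\mathbb{R}^d$ and $c:\overline{\mathcal{O}}\to\mathbb{R}$ be continuous. If $v$ is a non-negative lower-semicontinuous function on $\overline{\mathcal{O}}$ which is a viscosity supersolution of $$\Delta_\infty^\gamma v+q(x)\cdot\nabla v\,|\nabla v|^{2-\gamma}+c(x)v^{3-\gamma}=0\quad\text{in }\mathcal{O},$$ then either $v\equiv0$ in $\mathcal{O}$ or $v>0$ in $\mathcal{O}$. Furthermore, assume that $\mathcal{O}$ satisfies an interior sphere condition and that $v(x)>v(z)=0$ for all $x\in\mathcal{O}$ and some $z\in\partial\mathcal{O}$. Then for some constant $\nu>0$, $$v(x)\ge\nu\,(r-|x-x_0|)\quad\text{for }x\in B_r(x_0),$$ where $B_r(x_0)\subset\mathcal{O}$ is a ball touching the point $z$.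
   Context: $B_r(x_0)$ is the open ball of radius $r$ centered at $x_0$; it touches $z$ if $z\in\partial B_r(x_0)$. For a $C^2$ function $\varphi$, $\Delta_\infty^\gamma\varphi=|\nabla\varphi|^{-\gamma}\sum_{i,j=1}^d\partial_{x_i}\varphi\,\partial_{x_ix_j}\varphi\,\partial_{x_j}\varphi$. Viscosity sense: a lower-semicontinuous $u$ is a supersolution of $\Delta_\infty^\gamma u+G(x,u,\nabla u)=0$ in an open set $U\subset\mathbb{R}^d$ (with $G$ continuous) if, whenever $x_0\in U$ and $\varphi$ is $C^2$ near $x_0$ with $u(x_0)=\varphi(x_0)$ and $u>\varphi$ in a punctured ball around $x_0$, one has $\Delta_\infty^\gamma\varphi(x_0)+G(x_0,u(x_0),\nabla\varphi(x_0))\le0$; if $\nabla\varphi(x_0)=0$, the term $\Delta_\infty^\gamma\varphi(x_0)$ is read as $0$ when $\gamma<2$ and as $m(D^2\varphi(x_0))=\min_{|\xi|=1}\langle\xi,D^2\varphi(x_0)\xi\rangle$ when $\gamma=2$. *)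

(* Defs.v *)
From HB Require Import structures.
From mathcomp Require Import all_boot all_order all_algebra.
From mathcomp Require Import all_classical all_reals all_analysis.

Set Implicit Arguments.
Unset Strict Implicit.
Unset Printing Implicit Defensive.
Import Order.TTheory GRing.Theory Num.Theory.
Import numFieldNormedType.Exports.
Local Open Scope classical_set_scope.
Local Open Scope ring_scope.

(* The library norm on ['rV[R]_d] is the sup norm; it yields the usual topology
   (hence the usual [continuous], [closure], [bounded_set], [derivable], ...),
   but Euclidean balls and lengths have to be defined separately. *)
Definition dotp (R : realType) (d : nat) (x y : 'rV[R]_d) : R :=
  \sum_(i < d) x 0 i * y 0 i.

Definition enorm (R : realType) (d : nat) (x : 'rV[R]_d) : R :=
  Num.sqrt (dotp x x).

Definition eball (R : realType) (d : nat) (x0 : 'rV[R]_d) (r : R) :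
    set 'rV[R]_d :=
  [set x | enorm (x - x0) < r].

Definition boundary (T : topologicalType) (A : set T) : set T :=
  closure A `\` interior A.

Definition bounded_domain (R : realType) (d : nat) (O : set 'rV[R]_d) : Prop :=
  [/\ O !=set0, open O, connected O & bounded_set O].

(* [u] is real-valued and only its values on [A] matter: the topology of
   [subspace A] isolates the points outside [A]. *)
Definition lsc_on (R : realType) (d : nat) (A : set 'rV[R]_d)
    (u : 'rV[R]_d -> R) : Prop :=
  lower_semicontinuous (fun x : subspace A => (u x)%:E).

Definition partial_deriv (R : realType) (d : nat) (i : 'I_d)
    (f : 'rV[R]_d -> R) (x : 'rV[R]_d) : R :=
  'D_(delta_mx 0 i) f x.

Definition gradient (R : realType) (d : nat) (f : 'rV[R]_d -> R)
    (x : 'rV[R]_d) : 'rV[R]_d :=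
  \row_(i < d) partial_deriv i f x.

Definition hessian (R : realType) (d : nat) (f : 'rV[R]_d -> R)
    (x : 'rV[R]_d) : 'M[R]_d :=
  \matrix_(i < d, j < d) partial_deriv j (partial_deriv i f) x.

Definition C2_near (R : realType) (d : nat) (x0 : 'rV[R]_d)
    (f : 'rV[R]_d -> R) : Prop :=
  \forall x \near x0, forall i j : 'I_d,
    [/\ derivable f x (delta_mx 0 i),
        {for x, continuous (partial_deriv i f)},
        derivable (partial_deriv i f) x (delta_mx 0 j) &
        {for x, continuous (partial_deriv j (partial_deriv i f))}].

(* Infimum over the unit sphere, attained by compactness. *)
Definition min_quad (R : realType) (d : nat) (M : 'M[R]_d) : R :=
  inf [set dotp xi (xi *m M^T) | xi in [set xi : 'rV[R]_d | enorm xi = 1]].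

(* Value at [x] of the operator on a C^2 function, with the conventions used
   for test functions where the gradient vanishes. *)
Definition inf_laplacian (R : realType) (d : nat) (gamma : R)
    (phi : 'rV[R]_d -> R) (x : 'rV[R]_d) : R :=
  let p := gradient phi x in
  let M := hessian phi x in
  if p == 0 then (if gamma == 2 then min_quad M else 0)
  else enorm p `^ (- gamma) *
       \sum_(i < d) \sum_(j < d) p 0 i * M i j * p 0 j.

(* The equation tested is  Delta_infty^gamma u + G(x, u, grad u) = 0. *)
Definition viscosity_supersolution (R : realType) (d : nat) (gamma : R)
    (U : set 'rV[R]_d) (G : 'rV[R]_d -> R -> 'rV[R]_d -> R)
    (u : 'rV[R]_d -> R) : Prop :=
  lsc_on U u /\
  forall (x0 : 'rV[R]_d) (phi : 'rV[R]_d -> R),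
    U x0 -> C2_near x0 phi -> u x0 = phi x0 ->
    (\forall x \near x0^', phi x < u x) ->
    inf_laplacian gamma phi x0 + G x0 (u x0) (gradient phi x0) <= 0.

Definition touches (R : realType) (d : nat) (x0 : 'rV[R]_d) (r : R)
    (z : 'rV[R]_d) : Prop :=
  boundary (eball x0 r) z.

Definition interior_sphere_condition (R : realType) (d : nat)
    (O : set 'rV[R]_d) : Prop :=
  forall z, boundary O z ->
    exists x0 r, [/\ 0 < r, eball x0 r `<=` O & touches x0 r z].

(* Main.v *)
Require Import Defs.
From HB Require Import structures.
From mathcomp Require Import all_boot all_order all_algebra.
From mathcomp Require Import all_classical all_reals all_analysis.
From mathcomp Require Import ring lra.
Import Order.TTheory GRing.Theory Num.Theory.
Import numFieldNormedType.Exports.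
Local Open Scope classical_set_scope.
Local Open Scope ring_scope.

(* Let B be a ball inside the positivity set of v, of radius r and centre x0.
   For large a, the radial function g = exp(-a |x - x0|^2) is a strict
   subsolution on the half annulus r/2 <= |x - x0| <= r: its gradient does not
   vanish there, and the second radial derivative, of order a^2 g, beats the
   drift (order a g) and the zero order term (order g, as v <= k g at the points
   of contact).  Hence k g - C never touches v from below there, and with k the
   minimum of v on the inner half ball, k (g - exp(-a r^2)) <= v on B; this
   difference grows linearly from the boundary of B, which is the Hopf bound.
   If v vanishes somewhere in the domain but not everywhere, connectedness gives
   a positivity ball touching an interior zero z of v; as the barrier is
   nonpositive off the ball it then touches v from below at z itself, which has
   just been excluded. *)

(** * Euclidean inner product, and its squared distance against the sup-norm topology *)

Section Euclid.
Context {R : realType} {d : nat}.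
Implicit Types (x y z : 'rV[R]_d) (a : R).

Lemma dotpC x y : dotp x y = dotp y x.
Proof. by apply: eq_bigr => i _; rewrite mulrC. Qed.

Lemma dotpZr a x y : dotp x (a *: y) = a * dotp x y.
Proof. by rewrite /dotp mulr_sumr; apply: eq_bigr => i _; rewrite mxE mulrCA. Qed.

Lemma dotpZl a x y : dotp (a *: x) y = a * dotp x y.
Proof. by rewrite dotpC dotpZr dotpC. Qed.

Lemma dotpBr x y z : dotp x (y - z) = dotp x y - dotp x z.
Proof. by rewrite /dotp -sumrB; apply: eq_bigr => i _; rewrite !mxE mulrBr. Qed.

Lemma dotpBl x y z : dotp (x - y) z = dotp x z - dotp y z.
Proof. by rewrite dotpC dotpBr !(dotpC z). Qed.

Lemma dotp_ge0 x : 0 <= dotp x x.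
Proof. by apply: sumr_ge0 => i _; rewrite -expr2 sqr_ge0. Qed.

Lemma dotp_eq0 x : (dotp x x == 0) = (x == 0).
Proof.
apply/eqP/eqP => [x0|->]; last by rewrite -(scale0r 0) dotpZl mul0r.
apply/rowP => i; rewrite mxE; apply/eqP; rewrite -sqrf_eq0 expr2; apply/eqP.
have h j : true -> 0 <= x 0 j * x 0 j by rewrite -expr2 sqr_ge0.
exact: (psumr_eq0P h x0).
Qed.

Lemma enorm_ge0 x : 0 <= enorm x.
Proof. exact: sqrtr_ge0. Qed.

Lemma sqr_enorm x : enorm x ^+ 2 = dotp x x.
Proof. by rewrite sqr_sqrtr ?dotp_ge0. Qed.

Lemma enormZ a x : enorm (a *: x) = `|a| * enorm x.
Proof. by rewrite /enorm dotpZl dotpZr mulrA sqrtrM -?expr2 ?sqr_ge0// sqrtr_sqr. Qed.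

Lemma enorm_le x a : 0 <= a -> (enorm x <= a) = (dotp x x <= a ^+ 2).
Proof. by move=> a0; rewrite -sqr_enorm ler_pXn2r// ?nnegrE ?enorm_ge0. Qed.

Lemma enorm_lt x a : 0 <= a -> (enorm x < a) = (dotp x x < a ^+ 2).
Proof. by move=> a0; rewrite -sqr_enorm ltr_pXn2r// ?nnegrE ?enorm_ge0. Qed.

(** The squared length of [dotp y y *: x - dotp x y *: y] equals [dotp y y] times the difference of
    the squared sides, so its nonnegativity suffices once [y] is nonzero. *)
Lemma Cauchy_Schwarz x y : `|dotp x y| <= enorm x * enorm y.
Proof.
rewrite -(@ler_pXn2r _ 2)// ?nnegrE ?mulr_ge0 ?enorm_ge0//.
rewrite exprMn !sqr_enorm real_normK ?num_real//.
have [/eqP|y0] := eqVneq (dotp y y) 0.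
  rewrite dotp_eq0 => /eqP ->.
  by rewrite -(scale0r 0) !dotpZr !mul0r expr0n mulr0.
have ygt0 : 0 < dotp y y by rewrite lt_neqAle eq_sym y0 dotp_ge0.
have := dotp_ge0 (dotp y y *: x - dotp x y *: y).
rewrite !(dotpBl, dotpBr, dotpZl, dotpZr) (dotpC y x) => h.
rewrite -subr_ge0 -(pmulr_rge0 _ ygt0).
by apply: le_trans h _; rewrite le_eqVlt; apply/orP; left; apply/eqP; ring.
Qed.

(** A triangle inequality that stays with squares: in each coordinate it is
    [(s + t)^2 <= 2 s^2 + 2 t^2], that is, [(s - t)^2 >= 0]. *)
Lemma dotp_sub_le x y z :
  dotp (x - z) (x - z) <= 2 * dotp (x - y) (x - y) + 2 * dotp (y - z) (y - z).
Proof.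
rewrite /dotp !mulr_sumr -big_split/=; apply: ler_sum => i _; rewrite !mxE.
by have := sqr_ge0 (x 0 i - y 0 i - (y 0 i - z 0 i)); nra.
Qed.

Lemma continuous_sqdist y : continuous (fun x => dotp (x - y) (x - y)).
Proof.
have -> : (fun x => dotp (x - y) (x - y)) =
    \sum_(i < d) ((fun x : 'rV[R]_d => (x 0 i - y 0 i) * (x 0 i - y 0 i))).
  apply/funext => x; rewrite fct_sumE; apply: eq_bigr => i _.
  by rewrite !mxE.
apply: (big_ind (fun f : 'rV[R]_d -> R => continuous f)).
- by move=> x; exact: cst_continuous.
- by move=> f g cf cg x; apply: continuousD; [exact: cf|exact: cg].
- move=> i _ x; have h : {for x, continuous (fun x : 'rV[R]_d => x 0 i - y 0 i)}.
    by apply: continuousB; [exact: coord_continuous|exact: cst_continuous].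
  exact: (continuousM h h).
Qed.

(** Each squared coordinate is at most the sum of all of them, so a Euclidean ball lies in the
    sup-norm ball of the same radius. *)
Lemma nbhs_sqdist x (V : set 'rV[R]_d) : nbhs x V ->
  exists2 e, 0 < e & forall y, dotp (y - x) (y - x) < e -> V y.
Proof.
move=> /nbhs_normP[e /= e0 eV]; exists (e ^+ 2); first by rewrite exprn_gt0.
move=> y yx; apply: eV; rewrite /ball_/= -opprB normrN.
rewrite [X in X < _]/Num.norm/= mx_normrE; apply/bigmax_ltP; split => //= -[i j] _.
rewrite ord1 /= -(@ltr_pXn2r _ 2)// ?nnegrE ?normr_ge0 ?(ltW e0)//.
apply: le_lt_trans yx; rewrite real_normK ?num_real// /dotp (bigD1 j)//= expr2.
by rewrite lerDl sumr_ge0// => k _; rewrite -expr2 sqr_ge0.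
Qed.

Lemma compact_closed_eball y a : compact [set x | dotp (x - y) (x - y) <= a].
Proof.
apply: bounded_closed_compact.
  exists (`|y| + (1 + `|a|)); split; first exact: num_real.
  move=> M hM x /= xa; apply: ltW; apply: le_lt_trans hM.
  rewrite -[x in X in X <= _](subrK y) addrC; apply: le_trans (ler_normD _ _) _.
  rewrite lerD2l [X in X <= _]/Num.norm/= mx_normrE.
  apply/bigmax_leP; split => /=; first by rewrite addr_ge0.
  move=> -[i j] _; rewrite ord1 /=.
  have /le_trans /(_ xa) h : `|(x - y) 0 j| ^+ 2 <= dotp (x - y) (x - y).
    rewrite real_normK ?num_real// /dotp (bigD1 j)//= expr2.
    by rewrite lerDl sumr_ge0// => k _; rewrite -expr2 sqr_ge0.
  (* A bound [t^2 <= a] gives [t <= 1 + |a|], whence the radius chosen above. *)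
  by have := ler_norm a; have := normr_ge0 a; nra.
have -> : [set x | dotp (x - y) (x - y) <= a] =
    (fun x => dotp (x - y) (x - y)) @^-1` [set t | t <= a] by [].
by apply: closed_comp (@closed_le _ a) => x _; exact: continuous_sqdist.
Qed.

End Euclid.

(** * Derivatives of the Gaussian barrier, and the operator applied to it *)

Section Calculus.
Context {R : realType} {d : nat}.
Implicit Types (x y z v : 'rV[R]_d) (f : 'rV[R]_d -> R).

(** Both difference quotients are the same function of the step; directional derivatives can thus be
    computed by the one-variable rules. *)
Lemma is_derive_line f x v (df : R) :
  is_derive (0 : R) (1 : R) (fun t : R => f (t *: v + x)) df <-> is_derive x v f df.
Proof.
have E : (fun h : R => h^-1 *: ((f \o shift x) (h *: v) - f x)) =
   (fun h : R => h^-1 *: (((fun t : R => f (t *: v + x)) \o shift 0) (h *: 1)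
                          - f (0 *: v + x))).
  apply/funext => h /=.
  by have -> : h *: (1 : R) = h := mulr1 h; rewrite addr0 scale0r add0r.
by split=> -[h1 h2]; split; rewrite /derivable /derive ?E// -E.
Qed.

Lemma is_derive_sqdist x v y :
  is_derive x v (fun z => dotp (z - y) (z - y)) (2 * dotp (x - y) v).
Proof.
apply/is_derive_line.
have -> : (fun t : R => dotp (t *: v + x - y) (t *: v + x - y)) =
   (fun t : R => dotp (x - y) (x - y) + t * (2 * dotp (x - y) v) + t * t * dotp v v).
  apply/funext => t; have -> : t *: v + x - y = (x - y) - (- t) *: v.
    by rewrite scaleNr opprK -addrA addrC.
  by rewrite !(dotpBl _ ((-t) *: v), dotpBr _ _ ((-t) *: v), dotpZl, dotpZr) (dotpC v); ring.
apply: is_derive_eq; rewrite !(scaler0, scale0r, add0r, addr0) /=.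
rewrite /GRing.scale/=; ring.
Qed.

Lemma is_derive_dotp x u y w :
  is_derive x u (fun z => dotp (z - y) w) (dotp u w).
Proof.
apply/is_derive_line.
have -> : (fun t : R => dotp (t *: u + x - y) w) =
   (fun t : R => dotp (x - y) w + t * dotp u w).
  apply/funext => t; have -> : t *: u + x - y = (x - y) - (- t) *: u.
    by rewrite scaleNr opprK -addrA addrC.
  by rewrite (dotpBl _ ((-t) *: u)) dotpZl mulNr opprK.
apply: is_derive_eq; rewrite !(scaler0, scale0r, add0r, addr0) /=.
rewrite /GRing.scale/=; ring.
Qed.

Lemma is_derive_expR_comp f x v df :
  is_derive x v f df -> is_derive x v (fun z => expR (f z)) (expR (f x) * df).
Proof.
move=> /is_derive_line h; apply/is_derive_line.
have -> : f x = f (0 *: v + x) by rewrite scale0r add0r.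
exact: (is_derive1_comp (is_derive_expR _) h).
Qed.

Lemma continuous_dotp y w : continuous (fun z => dotp (z - y) w).
Proof.
have -> : (fun x => dotp (x - y) w) =
    \sum_(i < d) ((fun x : 'rV[R]_d => (x 0 i - y 0 i) * w 0 i)).
  apply/funext => x; rewrite fct_sumE; apply: eq_bigr => i _.
  by rewrite !mxE.
apply: (big_ind (fun f : 'rV[R]_d -> R => continuous f)).
- by move=> x; exact: cst_continuous.
- by move=> f g cf cg x; apply: continuousD; [exact: cf|exact: cg].
- move=> i _ x; have h : {for x, continuous (fun x : 'rV[R]_d => x 0 i - y 0 i)}.
    by apply: continuousB; [exact: coord_continuous|exact: cst_continuous].
  by apply: continuousM h _; exact: cst_continuous.
Qed.

Lemma continuous_add f g x : {for x, continuous f} -> {for x, continuous g} ->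
  {for x, continuous (fun z => f z + g z)}.
Proof. by move=> cf cg; exact: continuousD. Qed.

Lemma continuous_sub f g x : {for x, continuous f} -> {for x, continuous g} ->
  {for x, continuous (fun z => f z - g z)}.
Proof. by move=> cf cg; exact: continuousB. Qed.

Lemma continuous_mul f g x : {for x, continuous f} -> {for x, continuous g} ->
  {for x, continuous (fun z => f z * g z)}.
Proof. by move=> cf cg; exact: continuousM. Qed.

Lemma continuous_mull (c : R) f x :
  {for x, continuous f} -> {for x, continuous (fun z => c * f z)}.
Proof. by move=> h; apply: continuousM => //; exact: cst_continuous. Qed.

Definition gauss (a : R) (x0 x : 'rV[R]_d) : R :=
  expR (- a * dotp (x - x0) (x - x0)).

Lemma gauss_gt0 a x0 x : 0 < gauss a x0 x.
Proof. exact: expR_gt0. Qed.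

Lemma continuous_gauss a x0 : continuous (gauss a x0).
Proof.
move=> x; apply: (continuous_comp (f := fun x => - a * dotp (x - x0) (x - x0))).
  by apply: continuous_mull; exact: continuous_sqdist.
exact: continuous_expR.
Qed.

Lemma is_derive_gauss a x0 x u :
  is_derive x u (gauss a x0) (gauss a x0 x * (- a * (2 * dotp (x - x0) u))).
Proof.
apply: is_derive_expR_comp.
have := is_deriveZ (- a) (is_derive_sqdist x u x0); exact.
Qed.

(* The quartic term makes a touching from below strict without changing the
   gradient and the Hessian at [x1]. *)
Definition test_fun (k a C : R) (x0 x1 x : 'rV[R]_d) : R :=
  k * gauss a x0 x - C - dotp (x - x1) (x - x1) * dotp (x - x1) (x - x1).

(** Derivative of [test_fun] in direction [w], in closed form so that it can be differentiated once
    more. *)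
Definition test_fun1 (k a : R) (x0 x1 w x : 'rV[R]_d) : R :=
  k * (gauss a x0 x * (- a * (2 * dotp (x - x0) w)))
  - 4 * (dotp (x - x1) (x - x1) * dotp (x - x1) w).

(** Derivative of [test_fun1] in direction [u], hence the mixed second derivative of [test_fun]. At
    [x = x1] the part with factor 4 vanishes. *)
Definition test_fun2 (k a : R) (x0 x1 w u x : 'rV[R]_d) : R :=
  k * (gauss a x0 x * (- a * (2 * dotp u w)) +
       (- a * (2 * dotp (x - x0) w)) *
       (gauss a x0 x * (- a * (2 * dotp (x - x0) u))))
  - 4 * (dotp (x - x1) (x - x1) * dotp u w +
         dotp (x - x1) w * (2 * dotp (x - x1) u)).

Lemma is_derive_test_fun k a C x0 x1 w x :
  is_derive x w (test_fun k a C x0 x1) (test_fun1 k a x0 x1 w x).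
Proof.
have hg := is_derive_gauss a x0 x w; have hs := is_derive_sqdist x w x1.
have h := is_deriveB (is_deriveB (is_deriveZ k hg) (is_derive_cst C x w))
  (is_deriveM hs hs).
by apply: (is_derive_eq (f := test_fun k a C x0 x1) h); rewrite /test_fun1 /GRing.scale/=; ring.
Qed.

Lemma is_derive_test_fun1 k a x0 x1 w u x :
  is_derive x u (test_fun1 k a x0 x1 w) (test_fun2 k a x0 x1 w u x).
Proof.
have hg := is_derive_gauss a x0 x u; have hs := is_derive_sqdist x u x1.
have h0 := is_derive_dotp x u x0 w; have h1 := is_derive_dotp x u x1 w.
have h := is_deriveB (is_deriveZ k (is_deriveM hg (is_deriveZ (- a) (is_deriveZ 2 h0))))
  (is_deriveZ 4 (is_deriveM hs h1)).
by apply: (is_derive_eq (f := test_fun1 k a x0 x1 w) h).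
Qed.

Lemma continuous_test_fun1 k a x0 x1 w : continuous (test_fun1 k a x0 x1 w).
Proof.
move=> x; rewrite /test_fun1; apply: continuous_sub; apply: continuous_mull; apply: continuous_mul.
- exact: continuous_gauss.
- do 2 apply: continuous_mull; exact: continuous_dotp.
- exact: continuous_sqdist.
- exact: continuous_dotp.
Qed.

Lemma continuous_test_fun2 k a x0 x1 w u : continuous (test_fun2 k a x0 x1 w u).
Proof.
move=> x; have cg := continuous_gauss a x0 x; have cs := continuous_sqdist x1 x.
have cd := fun y w => continuous_dotp y w x.
rewrite /test_fun2; apply: continuous_sub; apply: continuous_mull; apply: continuous_add; apply: continuous_mul => //.
- exact: cst_continuous.
- by do 2 apply: continuous_mull; exact: cd.
- by apply: continuous_mul => //; do 2 apply: continuous_mull; exact: cd.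
- exact: cst_continuous.
- exact: cd.
- by apply: continuous_mull; exact: cd.
Qed.

Lemma partial_test_fun k a C x0 x1 i :
  partial_deriv i (test_fun k a C x0 x1) = test_fun1 k a x0 x1 (delta_mx 0 i).
Proof.
apply/funext => x.
by case: (is_derive_test_fun k a C x0 x1 (delta_mx 0 i) x).
Qed.

Lemma partial2_test_fun k a C x0 x1 i j :
  partial_deriv j (partial_deriv i (test_fun k a C x0 x1)) =
  test_fun2 k a x0 x1 (delta_mx 0 i) (delta_mx 0 j).
Proof.
rewrite partial_test_fun; apply/funext => x.
by case: (is_derive_test_fun1 k a x0 x1 (delta_mx 0 i) (delta_mx 0 j) x).
Qed.

Lemma C2_near_test_fun k a C x0 x1 x : C2_near x (test_fun k a C x0 x1).
Proof.
apply: (@filterE _ (nbhs x)) => y i j; rewrite partial2_test_fun partial_test_fun; split.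
- by case: (is_derive_test_fun k a C x0 x1 (delta_mx 0 i) y).
- exact: continuous_test_fun1.
- by case: (is_derive_test_fun1 k a x0 x1 (delta_mx 0 i) (delta_mx 0 j) y).
- exact: continuous_test_fun2.
Qed.

Lemma dotp_delta x i : dotp x (delta_mx 0 i) = x 0 i.
Proof.
rewrite /dotp (bigD1 i)//= mxE !eqxx mulr1 big1 ?addr0// => j ji.
by rewrite mxE (negbTE ji) andbF mulr0.
Qed.

Lemma gradient_test_fun k a C x0 x1 :
  gradient (test_fun k a C x0 x1) x1 = (- (2 * a) * (k * gauss a x0 x1)) *: (x1 - x0).
Proof.
apply/rowP => i; rewrite [LHS]mxE partial_test_fun /test_fun1 !dotp_delta subrr.
by rewrite !mxE; ring.
Qed.

Lemma hessian_test_fun k a C x0 x1 i j :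
  hessian (test_fun k a C x0 x1) x1 i j =
  (k * gauss a x0 x1) *
  (4 * a ^+ 2 * (x1 - x0) 0 i * (x1 - x0) 0 j - 2 * a * (i == j)%:R).
Proof.
rewrite [LHS]mxE partial2_test_fun /test_fun2 !dotp_delta subrr.
rewrite (_ : dotp 0 0 = 0); last by apply/eqP; rewrite dotp_eq0.
by rewrite !mxE eqxx /=; ring.
Qed.

(** With [w = x1 - x0], the gradient is [b w] for [b = - 2 a e] and the Hessian is
    [e (4 a^2 w w^T - 2 a I)], so the quadratic form is [b^2 |w|^2 e (4 a^2 |w|^2 - 2 a)]. Here
    [b^2 |w|^2] is the squared length of the gradient and merges with its power [- gamma]. As the
    gradient is nonzero, the conventions at critical points do not enter. *)
Lemma inf_laplacian_test_fun gamma k a C x0 x1 :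
  let e := k * gauss a x0 x1 in let rho := enorm (x1 - x0) in
  0 < e -> 0 < a -> 0 < rho ->
  inf_laplacian gamma (test_fun k a C x0 x1) x1 =
  (2 * a * e * rho) `^ (2 - gamma) * e * (4 * a ^+ 2 * rho ^+ 2 - 2 * a).
Proof.
move=> e rho e0 a0 rho0.
have w0 : (x1 - x0 == 0) = false.
  by apply/negbTE; rewrite -dotp_eq0 -sqr_enorm expf_neq0// gt_eqF.
have b0 : 0 < 2 * a * e by rewrite mulr_gt0// mulr_gt0.
have P0 : 0 < 2 * a * e * rho by rewrite mulr_gt0.
rewrite /inf_laplacian gradient_test_fun -/e scaler_eq0 w0 orbF.
rewrite mulf_eq0 oppr_eq0 mulf_eq0 pnatr_eq0/= (gt_eqF a0) (gt_eqF e0)/=.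
rewrite enormZ -/rho.
have -> : `|- (2 * a) * e| * rho = 2 * a * e * rho.
  by rewrite mulNr normrN gtr0_norm.
rewrite powRD ?(gt_eqF P0) ?implybT// powR_mulrn ?(ltW P0)//.
rewrite -[RHS]mulrA (mulrC (_ ^+ 2)) -[RHS]mulrA; congr (_ * _).
set b := - (2 * a) * e; set w := x1 - x0.
have bw i : (b *: w) 0 i = b * w 0 i by rewrite mxE.
have inner i : \sum_(j < d) (b *: w) 0 i * hessian (test_fun k a C x0 x1) x1 i j *
      (b *: w) 0 j =
    b ^+ 2 * e * (4 * a ^+ 2 * dotp w w - 2 * a) * (w 0 i * w 0 i).
  under eq_bigr => j _ do rewrite hessian_test_fun -/e -/w !bw.
  transitivity (\sum_(j < d) (b ^+ 2 * e * 4 * a ^+ 2 * (w 0 i * w 0 i) * (w 0 j * w 0 j)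
      - b ^+ 2 * e * 2 * a * w 0 i * w 0 j * (i == j)%:R)).
    by apply: eq_bigr => j _; ring.
  rewrite sumrB -mulr_sumr -/(dotp w w) [X in _ - X](bigD1 i)//= eqxx big1 ?addr0 ?mulr1.
    ring.
  by move=> j /negbTE; rewrite eq_sym => ->; rewrite mulr0.
under eq_bigr => i _ do rewrite inner.
rewrite -mulr_sumr -/(dotp w w) /rho sqr_enorm -/w /b.
rewrite !exprMn sqr_enorm; ring.
Qed.
End Calculus.

(** * Semicontinuity on compact sets, and exclusion of contact with the barrier *)

Section Touching.
Context {R : realType} {d : nat}.

Lemma lsc_on_near (A : set 'rV[R]_d) (u : 'rV[R]_d -> R) x a :
  lsc_on A u -> A x -> a < u x -> \forall y \near x, A y -> a < u y.
Proof.
move=> lu Ax ax; have [|V /=] := lu x a; first by rewrite lte_fin.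
move=> VA hV; have {}VA : nbhs x [set y | A y -> V y].
  by move: VA; rewrite /nbhs/= -(nbhs_subspace_in Ax).
move: VA; apply: filterS => y VAy Ay.
by have := hV _ (VAy Ay); rewrite lte_fin.
Qed.

(** If the infimum [m] is not attained, every point of [K] has a level above [m] that [f] exceeds
    nearby. The covering form of compactness, along the filter of levels decreasing to [m], yields a
    single [i > m] below [f] on all of [K], a contradiction. *)
Lemma lsc_attains_min {T : topologicalType} (K : set T) (f : T -> R) (b : R) :
  compact K -> K !=set0 -> (forall x, K x -> b <= f x) ->
  (forall x a, K x -> a < f x -> \forall y \near x, K y -> a < f y) ->
  exists2 x, K x & forall y, K y -> f x <= f y.
Proof.
move=> cK [x0 Kx0] fb lf; apply: contrapT => nex.
pose m := inf (f @` K).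
have lbf : has_lbound (f @` K) by exists b => _ [x Kx <-]; exact: fb.
have mf x : K x -> m < f x.
  move=> Kx; rewrite ltNge; apply/negP => fm; apply: nex; exists x => // y Ky.
  by apply: le_trans fm _; apply: ge_inf => //; exists y.
have /compact_near_coveringP := cK.
move=> /(_ R (m^'+) (fun i y => K y -> i < f y) _) [].
  move=> x Kx; pose a := (m + f x) / 2.
  have [ma af] : m < a /\ a < f x by have := mf _ Kx; rewrite /a; split; lra.
  exists ([set y | K y -> a < f y], [set i | i < a]); first split => /=.
  - exact: lf.
  - exact: nbhs_right_lt.
  - by move=> [y i] /= [h ia] /h; exact: lt_trans.
move=> e /= e0 he; pose i := m + e / 2.
have mi : m < i by rewrite /i; lra.
have /(_ _) hi : K `<=` (fun y => K y -> i < f y).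
  apply: he => //=; rewrite /i opprD addNKr normrN gtr0_norm; lra.
have : i <= m.
  apply: lb_le_inf; first by exists (f x0); exists x0.
  by move=> _ [x Kx <-]; apply: ltW; apply: hi.
by rewrite leNgt mi.
Qed.

Lemma continuous_compact_bounded {T : topologicalType} (K : set T) (f : T -> R) :
  compact K -> {within K, continuous f} ->
  exists M, forall x, K x -> `|f x| <= M.
Proof.
move=> cK cf; have := compact_bounded (continuous_compact cf cK).
move=> [M [_ hM]]; exists (M + 1) => x Kx.
by apply: (hM (M + 1)); [rewrite ltrDl | exists x].
Qed.

(** Every term of the tested inequality is measured in units of [A * e], where [A] is the gradient
    length to the power [2 - gamma]. The operator gives [4 a^2 rho^2 - 2 a], the drift at least
    [- 2 a rho Q] and the zero order term at least [- M]. Their sum is positive, whereas a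
    supersolution makes it at most 0. *)
Lemma no_touching (gamma : R) (O : set 'rV[R]_d) (q : 'rV[R]_d -> 'rV[R]_d)
    (c v : 'rV[R]_d -> R) (k a C Q M : R) (x0 x1 : 'rV[R]_d) :
  gamma <= 2 ->
  viscosity_supersolution gamma O
    (fun x s p => dotp (q x) p * enorm p `^ (2 - gamma)
                  + c x * s `^ (3 - gamma)) v ->
  O x1 -> 0 < k -> 0 < a -> 0 <= v x1 <= k * gauss a x0 x1 ->
  v x1 = k * gauss a x0 x1 - C ->
  (\forall x \near x1, k * gauss a x0 x - C <= v x) ->
  enorm (q x1) <= Q -> `|c x1| <= M ->
  let rho := enorm (x1 - x0) in 1 <= 2 * a * rho ->
  2 * a * rho * Q + M < 4 * a ^+ 2 * rho ^+ 2 - 2 * a -> False.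
Proof.
move=> g2 [_ sup] Ox1 k0 a0 /andP[v0 ve] vC near_le qQ cM rho arho big.
set e := k * gauss a x0 x1 in ve vC.
have e0 : 0 < e by rewrite mulr_gt0// gauss_gt0.
have rho0 : 0 < rho.
  rewrite lt_neqAle eq_sym enorm_ge0 andbT; apply/eqP => r0.
  by move: arho; rewrite r0 mulr0 ler10.
have tx1 : v x1 = test_fun k a C x0 x1 x1.
  by rewrite vC /test_fun subrr -(scale0r 0) dotpZl !mul0r subr0.
have strict : \forall x \near x1^', test_fun k a C x0 x1 x < v x.
  move: near_le; apply: filterS => x hx xx1; apply: lt_le_trans hx.
  rewrite ltrBlDr ltrDl mulr_gt0// lt_neqAle dotp_ge0 andbT eq_sym dotp_eq0.
    by rewrite subr_eq0.
  by rewrite subr_eq0.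
have := sup x1 (test_fun k a C x0 x1) Ox1 (C2_near_test_fun _ _ _ _ _ _) tx1 strict.
rewrite inf_laplacian_test_fun// gradient_test_fun -/e -/rho.
have b0 : 0 < 2 * a * e by rewrite mulr_gt0// mulr_gt0.
rewrite dotpZr enormZ mulNr normrN gtr0_norm// -/rho.
set P := 2 * a * e * rho.
have P0 : 0 < P by rewrite mulr_gt0.
set A := P `^ (2 - gamma).
have A0 : 0 < A by exact: powR_gt0.
(* One power of [v x1] is bounded by [e]. The remaining power [2 - gamma] uses [v x1 <= e <= P], and
   [e <= P] is where [1 <= 2 a rho] enters. *)
have eA : v x1 `^ (3 - gamma) <= A * e.
  have -> : 3 - gamma = (2 - gamma) + 1 by ring.
  have g20 : 0 <= 2 - gamma by rewrite subr_ge0.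
  rewrite powRD; last by rewrite gt_eqF// ltr_wpDl.
  rewrite powRr1//; apply: ler_pM => //; first exact: powR_ge0.
  apply: ge0_ler_powR => //; rewrite ?nnegrE ?(ltW P0)//.
  apply: le_trans ve _; rewrite /P mulrAC -[X in X <= _]mul1r.
  by rewrite ler_wpM2r// ltW.
have cv : - (M * (A * e)) <= c x1 * v x1 `^ (3 - gamma).
  have M0 : 0 <= M by exact: le_trans cM.
  have := normr_ge0 (c x1 * v x1 `^ (3 - gamma)).
  have : `|c x1 * v x1 `^ (3 - gamma)| <= M * (A * e).
    by rewrite normrM ler_pM// ger0_norm// powR_ge0.
  by rewrite ler_norml => /andP[].
have qw : - (Q * rho) <= - dotp (q x1) (x1 - x0).
  rewrite lerN2; apply: le_trans (ler_norm _) _.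
  by apply: le_trans (Cauchy_Schwarz _ _) _; rewrite ler_wpM2r// enorm_ge0.
have key : 0 < A * e * (4 * a ^+ 2 * rho ^+ 2 - 2 * a)
     + 2 * a * e * (- (Q * rho)) * A - M * (A * e).
  have : 0 < A * e * (4 * a ^+ 2 * rho ^+ 2 - 2 * a - (2 * a * rho * Q + M)).
    by apply: mulr_gt0; [exact: mulr_gt0 | rewrite subr_gt0].
  by apply: etrans; congr (_ < _); ring.
move=> h; have : (0 : R) < 0; last by rewrite ltxx.
apply: lt_le_trans h; apply: lt_le_trans key _.
have -> : - (2 * a * e) * dotp (q x1) (x1 - x0) * A =
  2 * a * e * (- dotp (q x1) (x1 - x0)) * A by ring.
rewrite -addrA; apply: lerD => //; apply: lerD => //.
by rewrite ler_pM2r// ler_pM2l.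
Qed.
End Touching.

(** * The exponential barrier below [v] on a ball of positivity *)

Section Barrier.
Context {R : realType} {d : nat}.

(** Shrinking [x - x0] by the factor [1 - t] moves [x] into the open ball. The choice of [t] ensures
    [t < 1] and [t r^2 < e], so the squared displacement stays below [e]. *)
Lemma closed_eball_closure (x0 x : 'rV[R]_d) (r : R) : 0 < r ->
  dotp (x - x0) (x - x0) <= r ^+ 2 -> closure (eball x0 r) x.
Proof.
move=> r0 xr V /nbhs_sqdist[e e0 eV].
have r20 : 0 < r ^+ 2 by rewrite exprn_gt0.
have D0 : 0 < e + r ^+ 2 + 1 by lra.
pose t := e / (e + r ^+ 2 + 1).
have t0 : 0 < t by rewrite divr_gt0.
have t1 : t < 1 by rewrite ltr_pdivrMr//; lra.
have te : t * r ^+ 2 < e.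
  have : t * (e + r ^+ 2 + 1) = e by rewrite divfK// gt_eqF.
  by nra.
have S0 := dotp_ge0 (x - x0); set S := dotp _ _ in S0 xr.
have tS0 : 0 <= t * S by rewrite mulr_ge0// ltW.
have tS : t * S < e by apply: le_lt_trans te; rewrite ler_pM2l.
have tr0 : 0 < t * r ^+ 2 by rewrite mulr_gt0.
exists (x - t *: (x - x0)); split; last first.
  apply: eV; rewrite addrAC subrr sub0r -scaleNr dotpZl dotpZr -/S; nra.
have -> : eball x0 r (x - t *: (x - x0)) =
    (enorm ((1 - t) *: (x - x0)) < r).
  by rewrite /eball/= scalerBl scale1r addrAC.
rewrite enorm_lt ?ltW// dotpZl dotpZr -/S.
have : (1 - t) * S <= (1 - t) * r ^+ 2 by rewrite ler_wpM2l// subr_ge0 ltW.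
have : 0 <= (1 - t) * S by rewrite mulr_ge0// subr_ge0 ltW.
by nra.
Qed.

(** The two inequalities at radius [r] accompany the bound so that [no_touching] can later be
    applied at a zero of [v] lying on the sphere and inside [O]. *)
Lemma hopf_barrier (gamma : R) (O : set 'rV[R]_d) (q : 'rV[R]_d -> 'rV[R]_d)
    (c v : 'rV[R]_d -> R) (Q M : R) (x0 : 'rV[R]_d) (r : R) :
  gamma <= 2 ->
  (forall x, closure O x -> 0 <= v x) -> lsc_on (closure O) v ->
  viscosity_supersolution gamma O
    (fun x s p => dotp (q x) p * enorm p `^ (2 - gamma)
                  + c x * s `^ (3 - gamma)) v ->
  (forall x, O x -> enorm (q x) <= Q) -> (forall x, O x -> `|c x| <= M) ->
  0 < r -> eball x0 r `<=` O -> (forall x, eball x0 r x -> 0 < v x) ->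
  exists k a, [/\ 0 < k, 0 < a, 1 <= 2 * a * r,
    2 * a * r * Q + M < 4 * a ^+ 2 * r ^+ 2 - 2 * a &
    forall x, dotp (x - x0) (x - x0) <= r ^+ 2 ->
      k * gauss a x0 x - k * expR (- a * r ^+ 2) <= v x].
Proof.
move=> g2 v0 lv sup qQ cM r0 BO vB.
have Bx0 : eball x0 r x0.
  by rewrite /eball/= subrr enorm_lt ?ltW// -(scale0r 0) dotpZl mul0r exprn_gt0.
have d0 : dotp (0 : 'rV[R]_d) 0 = 0 by apply/eqP; rewrite dotp_eq0.
have OcO x : O x -> closure O x := @subset_closure _ O x.
have BB x : dotp (x - x0) (x - x0) < r ^+ 2 -> eball x0 r x.
  by rewrite /eball/= enorm_lt ?ltW.
have half_lt x : dotp (x - x0) (x - x0) <= (r / 2) ^+ 2 ->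
    dotp (x - x0) (x - x0) < r ^+ 2.
  by move/le_lt_trans; apply; rewrite ltr_pXn2r ?nnegrE ?divr_ge0 ?ltW//; lra.
have Q0 : 0 <= Q := le_trans (enorm_ge0 _) (qQ _ (BO _ Bx0)).
have M0 : 0 <= M := le_trans (normr_ge0 _) (cM _ (BO _ Bx0)).
(* The three summands give [a >= 1], [a r >= 1] and [a r^2 >= 3 + 2 r Q + M]. For [rho >= r / 2]
   then [4 a^2 rho^2 >= a^2 r^2 >= a (3 + 2 r Q + M)], which exceeds [2 a + 2 a r Q + M]. *)
pose a := 1 + r^-1 + (3 + 2 * r * Q + M) / r ^+ 2.
have r20 : 0 < r ^+ 2 by rewrite exprn_gt0.
have rQ0 : 0 <= r * Q by rewrite mulr_ge0// ltW.
have ri0 : 0 < r^-1 by rewrite invr_gt0.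
have T0 : 0 <= (3 + 2 * r * Q + M) / r ^+ 2 by rewrite divr_ge0 ?(ltW r20)//; lra.
have a1 : 1 <= a by rewrite /a; lra.
have a0 : 0 < a by lra.
have ar : 1 <= a * r.
  have : r^-1 * r = 1 by rewrite mulVf// gt_eqF.
  by rewrite /a; nra.
have ar2 : 3 + 2 * r * Q + M <= a * r ^+ 2.
  have : (3 + 2 * r * Q + M) / r ^+ 2 * r ^+ 2 = 3 + 2 * r * Q + M.
    by rewrite divfK// gt_eqF.
  by rewrite /a; nra.
have big rho : r / 2 <= rho <= r ->
    1 <= 2 * a * rho /\ 2 * a * rho * Q + M < 4 * a ^+ 2 * rho ^+ 2 - 2 * a.
  move=> /andP[h1 h2]; split; first by nra.
  have : 2 * a * rho * Q <= 2 * a * (r * Q).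
    by rewrite -!mulrA ler_pM2l// ler_pM2l// ler_wpM2r.
  have : a * (3 + 2 * r * Q + M) <= a * (a * r ^+ 2) by rewrite ler_pM2l.
  have : r ^+ 2 <= 4 * rho ^+ 2 by nra.
  have : M <= a * M by rewrite ler_peMl.
  move=> t1 t2 t3 t4.
  have : a ^+ 2 * r ^+ 2 <= a ^+ 2 * (4 * rho ^+ 2) by rewrite ler_pM2l// exprn_gt0.
  by lra.
have gauss1 x : gauss a x0 x <= 1.
  by rewrite /gauss -expR0 ler_expR mulNr oppr_le0 mulr_ge0 ?dotp_ge0 ?ltW.
(* The minimum over the closed half ball is attained at a point of the open ball, hence is positive;
   it serves as [k]. *)
have [xm xmB vxm] : exists2 x, dotp (x - x0) (x - x0) <= (r / 2) ^+ 2 &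
    forall y, dotp (y - x0) (y - x0) <= (r / 2) ^+ 2 -> v x <= v y.
  apply: (lsc_attains_min _ _ 0 (compact_closed_eball x0 ((r / 2) ^+ 2))).
  - by exists x0; rewrite /= subrr d0 sqr_ge0.
  - by move=> x /half_lt/BB/BO/OcO; exact: v0.
  - move=> x t /half_lt/BB/BO/OcO Ox tx; have := lsc_on_near _ _ _ _ lv Ox tx.
    by apply: filterS => y hy /half_lt/BB/BO/OcO.
pose k := v xm.
have k0 : 0 < k by apply/vB/BB/half_lt.
have [b1 b2] : 1 <= 2 * a * r /\ 2 * a * r * Q + M < 4 * a ^+ 2 * r ^+ 2 - 2 * a.
  by apply: big; lra.
exists k, a; split => //.
pose f x := v x - (k * gauss a x0 x - k * expR (- a * r ^+ 2)).
have KO x : dotp (x - x0) (x - x0) <= r ^+ 2 -> closure O x.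
  by move=> /(closed_eball_closure _ _ _ r0); exact: closure_subset.
have [x1 Kx1 fx1] : exists2 x, dotp (x - x0) (x - x0) <= r ^+ 2 &
    forall y, dotp (y - x0) (y - x0) <= r ^+ 2 -> f x <= f y.
  (* The gap [f] is at least [- k] because [v >= 0] and the Gaussian is at most 1. *)
  apply: (lsc_attains_min _ _ (- k) (compact_closed_eball x0 (r ^+ 2))).
  - by exists x0; rewrite /= subrr d0 sqr_ge0.
  - move=> x /KO/v0 vx; have : k * gauss a x0 x <= k by rewrite ger_pMr.
    have : 0 < k * expR (- a * r ^+ 2) by rewrite mulr_gt0// expR_gt0.
    by rewrite /f; lra.
  - move=> x t /KO Kx tx.
    have h1 : \forall y \near x, closure O y -> v x - (f x - t) / 2 < v y.
      by apply: lsc_on_near => //; lra.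
    have h2 : \forall y \near x, k * gauss a x0 y < k * gauss a x0 x + (f x - t) / 2.
      have cg : {for x, continuous (fun y => k * gauss a x0 y)}.
        by apply: continuous_mull; exact: continuous_gauss.
      by apply: (cvgr_lt _ cg); lra.
    near=> y; move=> /KO Ky.
    have : closure O y -> v x - (f x - t) / 2 < v y by near: y.
    move=> /(_ Ky); have : k * gauss a x0 y < k * gauss a x0 x + (f x - t) / 2 by near: y.
    by rewrite /f; lra.
suff fx10 : 0 <= f x1.
  by move=> x /fx1 /(le_trans fx10); rewrite subr_ge0.
rewrite leNgt; apply/negP => fneg.
have vx10 := v0 _ (KO _ Kx1).
have kE0 : 0 < k * expR (- a * r ^+ 2) by rewrite mulr_gt0// expR_gt0.
(* A negative minimum of the gap lies neither in the half ball, where the Gaussian term is at most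
   [k <= v], nor on the sphere, where the barrier vanishes. *)
have [x1in|x1out] := leP (dotp (x1 - x0) (x1 - x0)) ((r / 2) ^+ 2).
  have := vxm _ x1in; have : k * gauss a x0 x1 <= k by rewrite ger_pMr.
  by move: fneg; rewrite /f -/k; lra.
have [x1r|x1r] := eqVneq (dotp (x1 - x0) (x1 - x0)) (r ^+ 2).
  by move: fneg; rewrite /f /gauss x1r; lra.
have {}x1r : dotp (x1 - x0) (x1 - x0) < r ^+ 2 by rewrite lt_neqAle x1r.
have Ox1 : O x1 by apply: BO; rewrite /eball/= enorm_lt ?ltW.
have [|h1 h2] := big (enorm (x1 - x0)).
  by rewrite leNgt enorm_lt ?enorm_le ?divr_ge0 ?ltW// -leNgt ltW.
(* Lowering the barrier by the depth of the minimum makes it touch [v] from below at [x1], inside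
   the half annulus. *)
apply: (@no_touching _ _ gamma O q c v k a (k * gauss a x0 x1 - v x1) Q M x0 x1) => //.
- by rewrite vx10; move: fneg; rewrite /f; lra.
- by rewrite opprB addrCA subrr addr0.
- have : \forall x \near x1, dotp (x - x0) (x - x0) < r ^+ 2.
    exact: (cvgr_lt _ (continuous_sqdist x0 x1)).
  apply: filterS => x /ltW /fx1; rewrite /f; lra.
- exact: qQ.
- exact: cM.
Unshelve. all: by end_near. Qed.
End Barrier.

(** * Compactness of the closed domain, nearest zeros, and connectedness *)

Lemma bounded_set_closure {R : realType} {d : nat} (A : set 'rV[R]_d) :
  bounded_set A -> bounded_set (closure A).
Proof.
move=> [M [Mr hM]]; exists M; split => // N MN x cx.
have cB : closed [set y : 'rV[R]_d | `|y| <= N].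
  have := @closed_le _ N; apply: (@closed_comp _ _ (fun y : 'rV[R]_d => `|y|)) => y _.
  exact: norm_continuous.
by apply: cB; move: cx; apply: closure_subset => y Ay; exact: hM.
Qed.

Lemma closest_zero {R : realType} {d : nat} (A : set 'rV[R]_d)
    (v : 'rV[R]_d -> R) (y p : 'rV[R]_d) :
  (forall x, A x -> 0 <= v x) -> lsc_on A v ->
  [set x | dotp (x - y) (x - y) <= dotp (p - y) (p - y)] `<=` A -> v p = 0 ->
  exists z, [/\ v z = 0, dotp (z - y) (z - y) <= dotp (p - y) (p - y) &
    forall x, dotp (x - y) (x - y) < dotp (z - y) (z - y) -> 0 < v x].
Proof.
move=> v0 lv KA vp; set s := fun x => dotp (x - y) (x - y).
(* Off the zero set the squared distance is replaced by a value above its maximum on the ball, so a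
   minimiser must be a zero. Semicontinuity survives: positivity of [v] persists nearby, and at a
   zero the jumps go upwards. *)
pose f x := if v x == 0 then s x else s p + 1.
have [||||z Kz fz] := lsc_attains_min [set x | s x <= s p] f 0.
- exact: compact_closed_eball.
- by exists p => /=.
- by move=> x _; rewrite /f; case: ifP => _; rewrite ?addr_ge0 ?dotp_ge0.
- move=> x t Kx; rewrite /f; case: ifPn => [_ ts|vx ts].
    have cs : {for x, continuous s} by exact: continuous_sqdist.
    have : \forall w \near x, t < s w by exact: (cvgr_gt _ cs).
    apply: filterS => w tw Kw; case: ifP => // _.
    by apply: lt_trans tw _; rewrite (le_lt_trans Kw)// ltrDl.
  have vx0 : 0 < v x by rewrite lt_neqAle eq_sym vx v0//; exact: KA.
  have := lsc_on_near _ _ _ _ lv (KA _ Kx) vx0.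
  by apply: filterS => w hw Kw; rewrite gt_eqF// hw//; exact: KA.
have vz : v z = 0.
  have : f z <= s p by have := fz p (lexx _); rewrite /f vp eqxx.
  by rewrite /f; case: ifP => [/eqP//|_]; rewrite gerDl ler10.
exists z; split => // x xz.
have Kx : s x <= s p by apply: le_trans (ltW xz) Kz.
rewrite lt_neqAle v0 ?andbT; last exact: KA.
apply/eqP => vx; have := fz _ Kx; rewrite /f -vx vz !eqxx.
by rewrite leNgt xz.
Qed.

(** Otherwise [P] is the trace of its closure on [O], hence relatively open and closed, and
    connectedness gives [P = O]. *)
Lemma open_connected_frontier {T : topologicalType} (O P : set T) :
  connected O -> open P -> P !=set0 -> P `<=` O -> ~ (O `<=` P) ->
  exists2 p, O p /\ ~ P p & closure P p.
Proof.
move=> cO oP P0 PO nOP; apply: contrapT => nex; apply: nOP => x Ox.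
suff -> : P = O by [].
apply: cO => //; first by exists P => //; apply/seteqP; split => [y Py|y []//]; split=> //; exact: PO.
exists (closure P); first exact: closed_closure.
apply/seteqP; split => [y Py|y [ Oy cPy]].
  by split; [exact: PO | exact: subset_closure].
by apply: contrapT => nPy; apply: nex; exists y.
Qed.

(** * The linear bound on a touching ball, then the alternative for the zero set *)

Theorem theorem2p2 (R : realType) (d : nat) (d_gt0 : (0 < d)%N) (gamma : R)
    (gamma_ge0 : 0 <= gamma) (gamma_le2 : gamma <= 2)
    (O : set 'rV[R]_d) (domO : bounded_domain O)
    (q : 'rV[R]_d -> 'rV[R]_d) (c : 'rV[R]_d -> R)
    (q_cont : {within closure O, continuous q})
    (c_cont : {within closure O, continuous c})
    (v : 'rV[R]_d -> R)
    (v_ge0 : forall x, closure O x -> 0 <= v x)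
    (v_lsc : lsc_on (closure O) v)
    (v_super : viscosity_supersolution gamma O
       (fun x s p => dotp (q x) p * enorm p `^ (2 - gamma)
                     + c x * s `^ (3 - gamma)) v) :
  ((forall x, O x -> v x = 0) \/ (forall x, O x -> 0 < v x)) /\
  (interior_sphere_condition O ->
   forall z, boundary O z -> v z = 0 -> (forall x, O x -> v z < v x) ->
   forall x0 r, 0 < r -> eball x0 r `<=` O -> touches x0 r z ->
   exists2 nu : R, 0 < nu &
     forall x, eball x0 r x -> nu * (r - enorm (x - x0)) <= v x).
Proof.
have [_ oO cO bO] := domO.
have OcO x : O x -> closure O x := @subset_closure _ O x.
have cK : compact (closure O).
  apply: bounded_closed_compact; last exact: closed_closure.
  exact: bounded_set_closure.
have [Q qQ] : exists Q, forall x, O x -> enorm (q x) <= Q.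
  have cq : {within closure O, continuous (fun x => dotp (q x - 0) (q x - 0))}.
    by move=> x; exact: (continuous_comp (q_cont x) (continuous_sqdist 0 (q x))).
  have [M hM] := continuous_compact_bounded _ _ cK cq.
  exists (1 + M) => x /OcO/hM; rewrite subr0 -sqr_enorm ger0_norm ?sqr_ge0//.
  (* [(t - 1)^2 >= 0] turns [t^2 <= M] into [t <= 1 + M]. *)
  by have := sqr_ge0 (enorm (q x) - 1); nra.
have [M cM] : exists M, forall x, O x -> `|c x| <= M.
  by have [M hM] := continuous_compact_bounded _ _ cK c_cont; exists M => x /OcO/hM.
split; last first.
  move=> _ z _ vz vpos x0 r r0 BO _.
  have [|k [a [k0 a0 _ _ bar]]] :=
      hopf_barrier _ _ _ _ _ _ _ _ _ gamma_le2 v_ge0 v_lsc v_super qQ cM r0 BO.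
    by move=> x /BO/vpos; rewrite vz.
  (* The slope comes from [exp s >= 1 + s] at [s = a (r^2 - rho^2)], together with
     [r^2 - rho^2 >= r (r - rho)]. *)
  exists (k * expR (- a * r ^+ 2) * a * r); first by rewrite !mulr_gt0 ?expR_gt0.
  move=> x; rewrite /eball/= => xr.
  have : dotp (x - x0) (x - x0) <= r ^+ 2 by rewrite -enorm_le ltW.
  move/bar; apply: le_trans; rewrite /gauss -sqr_enorm.
  set rho := enorm _ in xr *; have rho0 : 0 <= rho := enorm_ge0 _.
  have -> : - a * rho ^+ 2 = - a * r ^+ 2 + a * (r ^+ 2 - rho ^+ 2) by ring.
  rewrite expRD -subr_ge0.
  have h := expR_ge1Dx (a * (r ^+ 2 - rho ^+ 2)).
  have E0 : 0 < k * expR (- a * r ^+ 2) by rewrite mulr_gt0// expR_gt0.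
  set X := expR (a * _) in h *; set E := expR _ in E0 *.
  have -> : k * (E * X) - k * E - k * E * a * r * (r - rho) =
    (k * E) * (X - 1 - a * (r * (r - rho))) by ring.
  rewrite mulr_ge0 ?(ltW E0)//.
  have : a * (r * (r - rho)) <= a * (r ^+ 2 - rho ^+ 2).
    by rewrite ler_pM2l//; nra.
  by lra.
have [[p0 [ Op0 vp0]]|npos] := pselect (exists p, O p /\ v p = 0); last first.
  right=> x Ox; rewrite lt_neqAle v_ge0 ?andbT; last exact: OcO.
  by apply/eqP => vx; apply: npos; exists x.
left=> a0 Oa0; apply: contrapT => va0.
have v_gt0 x : O x -> v x <> 0 -> 0 < v x.
  move=> Ox vx; rewrite lt_neqAle v_ge0 ?andbT; last exact: OcO.
  by rewrite eq_sym; exact/eqP.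
pose P := [set x | O x /\ 0 < v x].
have oP : open P.
  rewrite openE => x [ Ox vx]; have := lsc_on_near _ _ _ _ v_lsc (OcO _ Ox) vx.
  have := open_nbhs_nbhs (conj oO Ox); apply: filterS2 => y Oy vy.
  by split => //; exact: vy (OcO _ Oy).
have [p [ Op nPp] cPp] : exists2 p, O p /\ ~ P p & closure P p.
  apply: open_connected_frontier => //.
  - by exists a0; split => //; exact: v_gt0.
  - by move=> x [].
  - by move=> /(_ _ Op0)[_]; rewrite vp0 ltxx.
have vp : v p = 0.
  by apply: contrapT => vpn; apply: nPp; split => //; exact: v_gt0.
have [e e0 eO] := nbhs_sqdist _ _ (open_nbhs_nbhs (conj oO Op)).
(* The quarter compensates the factors 2 in [dotp_sub_le]: the closed ball around [y] through [p]
   then stays within squared distance [e] of [p], hence in [O]. *)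
have [y [ [ Oy vy] yp]] : P `&` [set y | dotp (y - p) (y - p) < e / 4] !=set0.
  apply: cPp.
  apply: (cvgr_lt _ (continuous_sqdist p p)).
  by rewrite subrr -(scale0r 0) dotpZl mul0r divr_gt0.
have dC : dotp (p - y) (p - y) = dotp (y - p) (y - p).
  by rewrite -opprB -scaleN1r dotpZl dotpZr !mulN1r opprK.
have BO x : dotp (x - y) (x - y) <= dotp (p - y) (p - y) -> O x.
  move=> xp; apply: eO; apply: le_lt_trans (dotp_sub_le x y p) _.
  by move: xp yp; rewrite dC /=; lra.
(* The ball around [y] through [p] may contain other zeros, so [p] is replaced by a zero nearest to
   [y]. *)
have [z [vz zp hz]] := closest_zero (closure O) v y p v_ge0 v_lsc
  (fun x h => OcO _ (BO x h)) vp.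
have Oz : O z := BO z zp.
pose r := enorm (z - y).
have r2 : r ^+ 2 = dotp (z - y) (z - y) by exact: sqr_enorm.
have r0 : 0 < r.
  rewrite lt_neqAle enorm_ge0 andbT eq_sym; apply/eqP => rz.
  have : z - y == 0 by rewrite -dotp_eq0 -r2 rz expr0n.
  by rewrite subr_eq0 => /eqP zy; move: vy; rewrite -zy vz ltxx.
have [||k [a [k0 apos b1 b2 bar]]] :=
    hopf_barrier _ _ _ _ _ _ _ y r gamma_le2 v_ge0 v_lsc v_super qQ cM r0.
- move=> x; rewrite /eball/= enorm_lt ?ltW// r2 => xz.
  by apply: BO; apply: le_trans (ltW xz) zp.
- by move=> x; rewrite /eball/= enorm_lt ?ltW// r2; exact: hz.
have gz : gauss a y z = expR (- a * r ^+ 2) by rewrite /gauss r2.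
(* With this constant the barrier vanishes on the sphere through [z]. It lies below [v] in the
   closed ball by [bar], and outside because it is negative there while [v >= 0]. *)
apply: (no_touching _ _ _ _ _ k a (k * expR (- a * r ^+ 2)) Q M y z
  gamma_le2 v_super Oz k0 apos _ _ _ (qQ _ Oz) (cM _ Oz) b1 b2).
- by rewrite vz lexx mulr_ge0 ?ltW// gauss_gt0.
- by rewrite vz gz subrr.
- have := open_nbhs_nbhs (conj oO Oz); apply: filterS => x Ox.
  have [/bar//|xr] := leP (dotp (x - y) (x - y)) (r ^+ 2).
  apply: le_trans (v_ge0 _ (OcO _ Ox)); rewrite subr_le0 ler_pM2l// ler_expR.
  by rewrite !mulNr lerN2 ler_pM2l// ltW.
Qed.
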